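(* Let $M$ be a linear maximal monotone operator on a real Hilbert space and $L=(I+M)^{-1}$ its resolvent. For every method in $\mathcal{A}_\infty$, every $y_0$, and every $k\ge0$ there exists a real polynomial $Q_k$ (depending on the trajectory) with $$Q_k(1)=1,\qquad\deg Q_k\le k,\qquad y_k=Q_k(L)y_0.$$ Consequently $r(y_k)=(L-I)Q_k(L)y_0$.
   Context: $J=(I+M)^{-1}$ is the resolvent (equal to $L$ here) and $r(y)=J(y)-y$. Class $\mathcal{A}_\infty$: a method which from $y_0$ performs at each iteration $k=0,1,2,\dots$ exactly one resolvent evaluation $x_k=J(v_k)$ at a query point $v_k$ in the affine hull of $\{y_0,x_0,\dots,x_{k-1}\}$ and then chooses $y_{k+1}$ in the affine hull of $\{y_0,x_0,\dots,x_k\}$, all (real, sum-one) coefficients being allowed to depend arbitrarily on everything observed so far. *)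

(* Defs.v *)
From HB Require Import structures.
From mathcomp Require Import all_boot all_order all_algebra sesquilinear.
From mathcomp Require Import boolp classical_sets reals.
From mathcomp Require Import topology normedtype.

Set Implicit Arguments.
Unset Strict Implicit.
Unset Printing Implicit Defensive.

Import Order.TTheory GRing.Theory Num.Theory.
Import numFieldNormedType.Exports.
Local Open Scope classical_set_scope.
Local Open Scope ring_scope.

(* A real Hilbert space is a complete normed module over the reals whose norm
   is the one induced by an inner product. *)
Definition norm_from_dot (R : realType) (H : completeNormedModType R)
    (dot : {dot H for idfun}) : Prop :=
  forall x : H, `|x| ^+ 2 = dot x x.

(* An operator M on H is set-valued: [M x u] means that (x, u) lies in the graph
   of M.  It is linear when its graph is a linear subspace of H * H, which
   covers everywhere defined linear maps, unbounded linear operators defined on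
   a subspace, and linear relations. *)
Definition linear_operator (R : realType) (H : completeNormedModType R)
    (M : H -> set H) : Prop :=
  M 0 0 /\
  forall (a : R) (x u y v : H), M x u -> M y v -> M (a *: x + y) (a *: u + v).

Definition monotone_operator (R : realType) (H : completeNormedModType R)
    (dot : {dot H for idfun}) (M : H -> set H) : Prop :=
  forall x u y v : H, M x u -> M y v -> 0 <= dot (x - y) (u - v).

Definition maximal_monotone (R : realType) (H : completeNormedModType R)
    (dot : {dot H for idfun}) (M : H -> set H) : Prop :=
  monotone_operator dot M /\
  forall N : H -> set H, monotone_operator dot N ->
    (forall x, M x `<=` N x) -> forall x, N x `<=` M x.

(* (I + M)^-1 as a function: a point x with v \in x + M x.  The default value 0
   is returned only if there is none; for maximal monotone M on a Hilbert space
   the point exists for every v (Minty) and is unique. *)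
Definition resolvent (R : realType) (H : completeNormedModType R)
    (M : H -> set H) (v : H) : H :=
  xget 0 [set x | [set x + u | u in M x] v].

Definition residual (R : realType) (H : completeNormedModType R)
    (J : H -> H) (y : H) : H := J y - y.

Definition affine_comb (R : realType) (H : completeNormedModType R)
    (c : nat -> R) (s : seq H) : H :=
  \sum_(i < size s) c i *: s`_i.

(* A method of the class A_infinity.  Both rules receive the list of points
   observed so far, [:: y0; x_0; ...; x_(k-1)] for the query v_k and
   [:: y0; x_0; ...; x_k] for the update y_(k+1), and return sum-one
   coefficients on these points.  The iteration index can be read off the size
   of the list, and all earlier queries v_j and iterates y_j are determined by
   the list and the method, so the coefficients depend on everything observed
   so far. *)
Record Ainf_method (R : realType) (H : completeNormedModType R) := AinfMethod {
  query_coef : seq H -> nat -> R;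
  update_coef : seq H -> nat -> R;
  query_coef_sum1 : forall s : seq H, s != [::] ->
    \sum_(i < size s) query_coef s i = 1;
  update_coef_sum1 : forall s : seq H, s != [::] ->
    \sum_(i < size s) update_coef s i = 1
}.

(* [observed A J y0 k] is [:: y0; x_0; ...; x_(k-1)]. *)
Fixpoint observed (R : realType) (H : completeNormedModType R)
    (A : Ainf_method H) (J : H -> H) (y0 : H) (k : nat) : seq H :=
  if k is k'.+1 then
    let s := observed A J y0 k' in rcons s (J (affine_comb (query_coef A s) s))
  else [:: y0].

Definition iterate (R : realType) (H : completeNormedModType R)
    (A : Ainf_method H) (J : H -> H) (y0 : H) (k : nat) : H :=
  if k is k'.+1 then
    let s := observed A J y0 k'.+1 in affine_comb (update_coef A s) s
  else y0.

(* Q(T) for an operator T on H. *)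
Definition poly_op (R : realType) (H : completeNormedModType R)
    (Q : {poly R}) (T : H -> H) (x : H) : H :=
  \sum_(i < size Q) Q`_i *: iter i T x.

(* Main.v *)
Require Import Defs.
From HB Require Import structures.
From mathcomp Require Import all_boot all_order all_algebra sesquilinear.
From mathcomp Require Import boolp classical_sets reals.
From mathcomp Require Import topology normedtype.
From mathcomp Require Import sequences ring lra.

Set Implicit Arguments.
Unset Strict Implicit.
Unset Printing Implicit Defensive.

Import Order.TTheory GRing.Theory Num.Theory.
Import numFieldNormedType.Exports.
Local Open Scope classical_set_scope.
Local Open Scope ring_scope.

(* Once L is known to be linear on the whole space, multiplication by 'X on
   polynomials mirrors an application of L, and sum-one combinations preserve
   the value 1 at 1.  Linearity of L amounts to Minty's theorem
   ran(I + M) = H.  For linear M, take the point of ran(I + M) closest to v (it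
   exists since (I + M)^-1 is nonexpansive and the graph of M is closed), and
   let w be the difference.  As w is orthogonal to ran(I + M), (w, w) is
   monotonically related to the graph of M, hence lies in it by maximality; so
   w + w is in ran(I + M) and w = 0. *)

(** * Inner product identities and a Cauchy criterion *)

Lemma dotC (R : realType) (H : lmodType R) (dot : {dot H for idfun}) (x y : H) :
  dot x y = dot y x.
Proof. by rewrite hermC expr0 mul1r. Qed.

Lemma normDsq (R : realType) (H : completeNormedModType R)
    (dot : {dot H for idfun}) (hdot : norm_from_dot dot) (x y : H) :
  `|x + y| ^+ 2 = `|x| ^+ 2 + 2 * dot x y + `|y| ^+ 2.
Proof.
rewrite !hdot linearDl !linearDr /= (dotC dot y x); ring.
Qed.

Lemma normBsq (R : realType) (H : completeNormedModType R)
    (dot : {dot H for idfun}) (hdot : norm_from_dot dot) (x y : H) :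
  `|x - y| ^+ 2 = `|x| ^+ 2 - 2 * dot x y + `|y| ^+ 2.
Proof. rewrite (normDsq hdot) normrN linearNr /=; ring. Qed.

(* Monotonicity becomes an inequality between norms, which passes to limits
   without using continuity of the inner product. *)
Lemma dot_ge0 (R : realType) (H : completeNormedModType R)
    (dot : {dot H for idfun}) (hdot : norm_from_dot dot) (x y : H) :
  (0 <= dot x y) = (`|x - y| <= `|x + y|).
Proof.
rewrite -[RHS]ler_sqr ?nnegrE // (normBsq hdot) (normDsq hdot).
by apply/idP/idP => ?; lra.
Qed.

(** The bound has the shape met by a minimizing sequence whose [n]-th term is within [1/(n+1)] of
    the infimum; completeness of [H] then supplies the limit. *)
Lemma cvg_of_sqr_dist (R : realType) (H : completeNormedModType R)
    (x : nat -> H) (C : R) :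
  (forall n m, `|x n - x m| ^+ 2 <= C * (n.+1%:R^-1 + m.+1%:R^-1)) ->
  cvg (x n @[n --> \oo]).
Proof.
move=> hx; apply/cauchy_cvgP/cauchyP => e e0.
have C0 : 0 <= C.
  by move: (hx 0 0); rewrite subrr normr0 expr0n /= invr1; lra.
have [N hN] : exists N : nat, 2 * C < e ^+ 2 * N.+1%:R.
  have c0 : 0 <= 2 * C / e ^+ 2 by apply: divr_ge0; [lra|exact: sqr_ge0].
  exists (Num.bound (2 * C / e ^+ 2)).
  rewrite [ltRHS]mulrC -ltr_pdivrMr ?exprn_gt0 //.
  by apply: (lt_trans (archi_boundP c0)); rewrite ltr_nat.
(* The ball is centred at [x N]: for [n >= N] the squared distance is at most [2C/(N+1)], which is
   below [e^2]. *)
exists (x N); exists N => // n /= Nn.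
rewrite -ball_normE /= -ltr_sqr ?nnegrE ?(ltW e0) //.
apply: (le_lt_trans (hx N n)).
apply: (@le_lt_trans _ _ (2 * C * N.+1%:R^-1)).
  rewrite -mulrA mulrCA; apply: ler_wpM2l => //.
  by rewrite mulr2n mulrDl mul1r lerD2l lef_pV2 ?posrE ?ltr0n // ler_nat.
by rewrite ltr_pdivrMr ?ltr0n.
Qed.

(** * Maximal monotone operators and the surjectivity of [I + M] *)

(** Adjoining the single pair [(x, u)] to the graph keeps it monotone, so maximality forces the pair
    to be there already. *)
Lemma maximal_monotone_related (R : realType) (H : completeNormedModType R)
    (dot : {dot H for idfun})
    (M : H -> set H) (hmax : maximal_monotone dot M) (x u : H) :
  (forall y v, M y v -> 0 <= dot (x - y) (u - v)) -> M x u.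
Proof.
case: hmax => hmon hmax h.
pose N y := [set v | M y v \/ (y = x /\ v = u)].
apply: (hmax N); last by right.
- move=> y v z w [yv|[-> ->]] [zw|[-> ->]].
  + exact: hmon.
  + by rewrite -opprB -[v - u]opprB linearNl linearNr /= opprK; exact: h.
  + exact: h.
  + by rewrite !subrr linear0l.
- by move=> y v; left.
Qed.

(** Being monotonically related to a fixed pair of the graph is a closed condition, so limits of
    graph points stay related to the whole graph. *)
Lemma maximal_monotone_cvg (R : realType) (H : completeNormedModType R)
    (dot : {dot H for idfun}) (hdot : norm_from_dot dot)
    (M : H -> set H) (hmax : maximal_monotone dot M)
    (xs us : nat -> H) (x u : H) :
  (forall n, M (xs n) (us n)) ->
  xs n @[n --> \oo] --> x -> us n @[n --> \oo] --> u -> M x u.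
Proof.
move=> hM hx hu; apply: (maximal_monotone_related hmax) => y v yv.
rewrite (dot_ge0 hdot).
have cx : (xs n - y) @[n --> \oo] --> x - y by apply: cvgB => //; exact: cvg_cst.
have cu : (us n - v) @[n --> \oo] --> u - v by apply: cvgB => //; exact: cvg_cst.
apply: (ler_cvg_to (cvg_norm (cvgB cx cu)) (cvg_norm (cvgD cx cu))).
by apply: nearW => n; rewrite -(dot_ge0 hdot); case: hmax => + _; exact.
Qed.

Lemma linear_operatorZ (R : realType) (H : completeNormedModType R)
    (M : H -> set H) (hlin : linear_operator M) (a : R) (x u : H) :
  M x u -> M (a *: x) (a *: u).
Proof.
by move=> xu; rewrite -[a *: x]addr0 -[a *: u]addr0; apply: hlin.2 xu hlin.1.
Qed.

(** Expanding the square on the right leaves a nonnegative cross term. Control of [x + u] thus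
    controls both components, which yields Cauchy sequences and uniqueness of the resolvent
    point. *)
Lemma monotone_expansive (R : realType) (H : completeNormedModType R)
    (dot : {dot H for idfun}) (hdot : norm_from_dot dot)
    (M : H -> set H) (hmon : monotone_operator dot M) (x u y v : H) :
  M x u -> M y v ->
  `|x - y| ^+ 2 + `|u - v| ^+ 2 <= `|(x + u) - (y + v)| ^+ 2.
Proof.
move=> xu yv; have := hmon _ _ _ _ xu yv.
rewrite opprD addrACA (normDsq hdot (x - y)); lra.
Qed.

Lemma minimal_dist_orthogonal (R : realType) (H : completeNormedModType R)
    (dot : {dot H for idfun}) (hdot : norm_from_dot dot) (w q : H) :
  (forall t : R, `|w| ^+ 2 <= `|w - t *: q| ^+ 2) -> dot w q = 0.
Proof.
move=> h; apply/eqP; rewrite -sqrf_eq0 eq_le sqr_ge0 andbT.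
(* Testing with [t = c / b], where [b] is one more than the squared norm of [q], avoids a separate
   case [q = 0] and still lowers the squared norm by [c^2 (b + 1) / b^2]. *)
have q0 : 0 < 1 + `|q| ^+ 2 by rewrite ltr_pwDl ?sqr_ge0.
set c := dot w q; set b := 1 + _ in q0.
have := h (c / b); rewrite (normBsq hdot) linearZr_LR /= normrZ exprMn.
rewrite real_normK ?num_real //.
rewrite -/c (_ : `|q| ^+ 2 = b - 1); last by rewrite /b; ring.
have -> : `|w| ^+ 2 - 2 * (c / b * c) + (c / b) ^+ 2 * (b - 1)
  = `|w| ^+ 2 - c ^+ 2 * (b + 1) / b ^+ 2 by field; lra.
rewrite lerBrDr gerDl pmulr_lle0 ?invr_gt0 ?exprn_gt0 //.
by rewrite pmulr_lle0 //; lra.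
Qed.

Lemma linear_minty (R : realType) (H : completeNormedModType R)
    (dot : {dot H for idfun}) (hdot : norm_from_dot dot)
    (M : H -> set H) (hlin : linear_operator M) (hmax : maximal_monotone dot M)
    (v : H) : exists x u, M x u /\ x + u = v.
Proof.
pose S := [set `|v - (z.1 + z.2)| ^+ 2 | z in [set z : H * H | M z.1 z.2]].
have hS : has_inf S.
  split; first by exists (`|v - (0 + 0)| ^+ 2); exists (0, 0) => //; exact: hlin.1.
  by exists 0 => _ [z _ <-]; exact: sqr_ge0.
set d := inf S.
have hd y w : M y w -> d <= `|v - (y + w)| ^+ 2.
  by move=> yw; apply: (ge_inf hS.2); exists (y, w).
have [z hz] : exists z : nat -> H * H, forall n,
    M (z n).1 (z n).2 /\ `|v - ((z n).1 + (z n).2)| ^+ 2 < d + n.+1%:R^-1.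
  suff /choice[z hz] : forall n : nat, exists z : H * H,
    M z.1 z.2 /\ `|v - (z.1 + z.2)| ^+ 2 < d + n.+1%:R^-1 by exists z.
  move=> n; have n0 : 0 < n.+1%:R^-1 :> R by rewrite invr_gt0 ltr0n.
  by have [_ [z zM <-] zd] := inf_adherent n0 hS; exists z.
have hdist n m : `|(z n).1 - (z m).1| ^+ 2 + `|(z n).2 - (z m).2| ^+ 2
    <= 2 * (n.+1%:R^-1 + m.+1%:R^-1).
  have [Mn dn] := hz n; have [Mm dm] := hz m.
  apply: (le_trans (monotone_expansive hdot hmax.1 Mn Mm)).
  (* The midpoint of two graph points lies in the graph by linearity, so the mean of their residuals
     has squared norm at least [d]. The parallelogram law then gives the factor 2:
     [2(d + a) + 2(d + b) - 4d = 2(a + b)]. *)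
  have hpq : d <= `|2^-1 *: ((v - ((z n).1 + (z n).2)) +
                             (v - ((z m).1 + (z m).2)))| ^+ 2.
    have := hd _ _ (hlin.2 2^-1 _ _ _ _ Mn (linear_operatorZ hlin 2^-1 Mm)).
    rewrite addrACA -!scalerDr [v - _ + _]addrACA -opprD scalerBr.
    by rewrite -[v + v]mulr2n -(scaler_nat 2 v) scalerA mulVf ?pnatr_eq0 //
       scale1r.
  have -> : (z n).1 + (z n).2 - ((z m).1 + (z m).2)
      = v - ((z m).1 + (z m).2) - (v - ((z n).1 + (z n).2)).
    by rewrite opprB [RHS]addrC subrKA.
  move: (v - _) (v - _) dn dm hpq => q p dn dm.
  rewrite normrZ exprMn real_normK ?num_real //.
  rewrite (normDsq hdot p q) (normBsq hdot) (dotC dot q).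
  move: n.+1%:R^-1 m.+1%:R^-1 dn dm => a b dn dm; rewrite exprVn; lra.
have cx : cvg ((z n).1 @[n --> \oo]).
  apply: (@cvg_of_sqr_dist _ _ _ 2) => n m; apply: le_trans (hdist n m).
  by rewrite lerDl sqr_ge0.
have cu : cvg ((z n).2 @[n --> \oo]).
  apply: (@cvg_of_sqr_dist _ _ _ 2) => n m; apply: le_trans (hdist n m).
  by rewrite lerDr sqr_ge0.
set x := lim ((z n).1 @[n --> \oo]); set u := lim ((z n).2 @[n --> \oo]).
have Mxu : M x u.
  by apply: (maximal_monotone_cvg hdot hmax _ cx cu) => n; case: (hz n).
exists x, u; split=> //.
have [w wE] : exists w, w = v - (x + u) by exists (v - (x + u)).
have wd : `|w| ^+ 2 <= d.
  have cw : `|v - ((z n).1 + (z n).2)| ^+ 2 @[n --> \oo] --> `|w| ^+ 2.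
    rewrite expr2; under eq_cvg do rewrite expr2.
    have cw : `|v - ((z n).1 + (z n).2)| @[n --> \oo] --> `|w|.
      by rewrite wE; apply: cvg_norm; apply: cvgB; [exact: cvg_cst|exact: cvgD].
    exact: cvgM.
  have cd : d + n.+1%:R^-1 @[n --> \oo] --> d + 0.
    by apply: cvgD; [exact: cvg_cst|exact: cvg_harmonic].
  rewrite -[d]addr0; apply: (ler_cvg_to cw cd).
  by apply: nearW => n; apply: ltW; case: (hz n).
(* Shifting [(x, u)] by [t] times [(y, q)] stays in the graph, so no such shift brings the residual
   below [d]. *)
have orth y q : M y q -> dot w (y + q) = 0.
  move=> yq; apply: (minimal_dist_orthogonal hdot) => t.
  apply: (le_trans wd); rewrite wE scalerDr -addrA -opprD addrACA.
  rewrite (addrC x) (addrC u); apply: hd.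
  exact: hlin.2.
have Mww : M w w.
  apply: (maximal_monotone_related hmax) => y q yq.
  (* By orthogonality the product to be bounded equals the squared norm of [w] plus [dot y q], and
     the latter is nonnegative by comparison with the pair [(0, 0)]. *)
  have := orth _ _ yq; have := hmax.1 _ _ _ _ yq hlin.1.
  rewrite !subr0 linearBl !linearBr !linearDr /= (dotC dot y w) -hdot.
  by have := sqr_ge0 `|w|; lra.
have := orth _ _ Mww; rewrite linearDr /= -hdot => w0.
have /eqP : `|w| ^+ 2 = 0 by lra.
by rewrite sqrf_eq0 normr_eq0 wE subr_eq0 => /eqP.
Qed.

(** * The resolvent as a linear map *)

(** Surjectivity of [I + M] rules out the default value of [xget], and expansiveness gives
    uniqueness. *)
Lemma resolventP (R : realType) (H : completeNormedModType R)
    (dot : {dot H for idfun}) (hdot : norm_from_dot dot)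
    (M : H -> set H) (hlin : linear_operator M) (hmax : maximal_monotone dot M)
    (v x : H) : M x (v - x) <-> resolvent M v = x.
Proof.
have h : M (resolvent M v) (v - resolvent M v).
  rewrite /resolvent; case: xgetP => [y _ [u yu <-]|hno]; first by rewrite addrAC subrr add0r.
  have [y [u [yu yuv]]] := linear_minty hdot hlin hmax v.
  by case: (hno y); exists u.
split=> [xv|<- //].
have := monotone_expansive hdot hmax.1 h xv.
rewrite !subrKC subrr normr0 expr0n /= => hle.
have /eqP : `|resolvent M v - x| ^+ 2 = 0.
  apply/eqP; rewrite eq_le sqr_ge0 andbT; apply: le_trans hle.
  by rewrite lerDl sqr_ge0.
by rewrite sqrf_eq0 normr_eq0 subr_eq0 => /eqP.
Qed.

(** The graph of the resolvent consists of the pairs [(x + u, x)] with [M x u], so it inherits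
    linearity from that of [M]. *)
Lemma resolvent_linear (R : realType) (H : completeNormedModType R)
    (dot : {dot H for idfun}) (hdot : norm_from_dot dot)
    (M : H -> set H) (hlin : linear_operator M) (hmax : maximal_monotone dot M) :
  linear (resolvent M).
Proof.
move=> a v w; apply/(resolventP hdot hlin hmax).
rewrite opprD addrACA -scalerBr.
by apply: hlin.2; apply/(resolventP hdot hlin hmax).
Qed.

(** * Polynomials in an operator *)

Lemma poly_op_trunc (R : realType) (H : completeNormedModType R)
    (Q : {poly R}) (T : H -> H) (x : H) (n : nat) : (size Q <= n)%N ->
  poly_op Q T x = \sum_(i < n) Q`_i *: iter i T x.
Proof.
move=> hn; rewrite /poly_op (big_ord_widen _ (fun i => Q`_i *: iter i T x) hn).
rewrite big_mkcond; apply: eq_bigr => i _; case: ltnP => // hi.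
by rewrite nth_default // scale0r.
Qed.

Lemma poly_op_sum (R : realType) (H : completeNormedModType R)
    (T : H -> H) (x : H) (m : nat) (c : nat -> R) (Q : nat -> {poly R}) :
  poly_op (\sum_(i < m) c i *: Q i) T x = \sum_(i < m) c i *: poly_op (Q i) T x.
Proof.
(* A common bound on all sizes, so that the two summations run over fixed ranges and can be
   exchanged. *)
pose n := maxn (size (\sum_(i < m) c i *: Q i)) (\max_(i < m) size (Q i)).
rewrite (@poly_op_trunc _ _ _ _ _ n) ?leq_maxl //.
under [RHS]eq_bigr => i _.
  rewrite (@poly_op_trunc _ _ _ _ _ n); last first.
    by rewrite leq_max (leq_bigmax i) orbT.
  rewrite scaler_sumr; over.
rewrite exchange_big; apply: eq_bigr => j _.
rewrite coef_sum scaler_suml; apply: eq_bigr => i _.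
by rewrite coefZ scalerA.
Qed.

Lemma poly_op_mulX (R : realType) (H : completeNormedModType R)
    (T : H -> H) (hT : linear T) (Q : {poly R}) (x : H) :
  poly_op (Q * 'X) T x = T (poly_op Q T x).
Proof.
pose T' := HB.pack_for {linear H -> H} T (GRing.isLinear.Build _ _ _ _ T hT).
rewrite (@poly_op_trunc _ _ _ _ _ (size Q).+1); last first.
  by have := size_mul_leq Q 'X; rewrite size_polyX addn2.
(* The constant term vanishes; each remaining term carries one more application of [T]. *)
rewrite big_ord_recl coefMX /= scale0r add0r.
rewrite /poly_op -[T in RHS]/(T' : H -> H) linear_sum.
by apply: eq_bigr => i _; rewrite linearZ coefMX.
Qed.

(** * Polynomial form of the trajectory *)

Section Trajectory.
Variables (R : realType) (H : completeNormedModType R) (A : Ainf_method H).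
Variables (L : H -> H) (hL : linear L) (y0 : H).

Lemma affine_comb_poly (c : nat -> R) (s : seq H) (Q : nat -> {poly R}) :
  \sum_(i < size s) c i = 1 ->
  (forall i, (i < size s)%N ->
    [/\ (Q i).[1] = 1, (size (Q i) <= size s)%N & s`_i = poly_op (Q i) L y0]) ->
  exists P : {poly R},
    [/\ P.[1] = 1, (size P <= size s)%N & affine_comb c s = poly_op P L y0].
Proof.
move=> hc hQ; exists (\sum_(i < size s) c i *: Q i); split.
- rewrite horner_sum -[RHS]hc; apply: eq_bigr => i _.
  by have [e _ _] := hQ i (ltn_ord i); rewrite hornerZ e mulr1.
- apply: (leq_trans (size_sum _ _ _)); apply/bigmax_leqP => i _.
  by apply: (leq_trans (size_scale_leq _ _)); case: (hQ i (ltn_ord i)).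
- rewrite poly_op_sum; apply: eq_bigr => i _.
  by case: (hQ i (ltn_ord i)) => _ _ ->.
Qed.

Lemma size_observed k : size (observed A L y0 k) = k.+1.
Proof. by elim: k => //= k IH; rewrite size_rcons IH. Qed.

(** One bound serves all [k + 1] observed points: polynomials of degree at most [k]. The next
    resolvent value raises the degree by one, just as the list grows by one. *)
Lemma observed_poly k : exists Q : nat -> {poly R}, forall i, (i < k.+1)%N ->
  [/\ (Q i).[1] = 1, (size (Q i) <= k.+1)%N &
      (observed A L y0 k)`_i = poly_op (Q i) L y0].
Proof.
elim: k => [|k [Q hQ]].
  exists (fun=> 1) => -[|//] _; split; rewrite ?hornerC ?size_poly1 //.
  by rewrite /poly_op size_poly1 big_ord1 coefC /= scale1r.
set s := observed A L y0 k in hQ *; have ss : size s = k.+1 by exact: size_observed.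
have s0 : s != [::] by rewrite -size_eq0 ss.
have [|P [P1 Ps Pe]] := affine_comb_poly (Q := Q) (query_coef_sum1 A s0).
  by rewrite ss.
(* [P] represents the query point, and multiplying it by ['X] represents its image under [L]; the
   value at 1 is unchanged. *)
exists (fun i => if i == k.+1 then P * 'X else Q i) => i.
rewrite ltnS leq_eqVlt /= -/s nth_rcons ss.
case: eqP => [-> _|_ /= ik].
  rewrite ltnn hornerMX P1 mulr1 Pe poly_op_mulX //; split=> //.
  apply: (leq_trans (size_mul_leq _ _)).
  by rewrite size_polyX addn2 ltnS -ss.
by rewrite ik; have [? /leqW ? ?] := hQ i ik.
Qed.

Lemma iterate_poly k : exists Q : {poly R},
  [/\ Q.[1] = 1, (size Q <= k.+1)%N & iterate A L y0 k = poly_op Q L y0].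
Proof.
case: k => [|k].
  have [Q /(_ 0%N isT) hQ] := observed_poly 0.
  by exists (Q 0%N).
(* The update already uses the newest resolvent value, hence [k + 2] points and degree at most
   [k + 1]. *)
have [Q hQ] := observed_poly k.+1.
have ss := size_observed k.+1.
have s0 : observed A L y0 k.+1 != [::] by rewrite -size_eq0 ss.
have := affine_comb_poly (Q := Q) (update_coef_sum1 A s0).
by rewrite ss; apply.
Qed.

End Trajectory.

Theorem lemma2p3 (R : realType) (H : completeNormedModType R)
    (dot : {dot H for idfun}) (hdot : norm_from_dot dot)
    (M : H -> set H) (hlin : linear_operator M) (hmax : maximal_monotone dot M)
    (A : Ainf_method H) (y0 : H) (k : nat) :
  let L := resolvent M in
  exists Q : {poly R},
    [/\ Q.[1] = 1,
        (size Q <= k.+1)%N,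
        iterate A L y0 k = poly_op Q L y0 &
        residual L (iterate A L y0 k) = (L \- idfun) (poly_op Q L y0)].
Proof.
move=> L.
have [Q [Q1 Qs Qe]] := iterate_poly A (resolvent_linear hdot hlin hmax) y0 k.
by exists Q; split=> //; rewrite Qe.
Qed.
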